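(* Let $T=(N_1,\ldots,N_t)$ be a problem instance of CPTs for $V_n$ and $P\subseteq\{V_1,\ldots,V_{n-1}\}$, and let $N^a$ be the CPT output by Algorithm 2 on input $(T,P)$. Then $f_T(N^a)\le f_T(N)$ for every CPT $N$ for $V_n$ with $Pa(N,V_n)\subseteq P$.
   Context: Binary attributes $V_1,\ldots,V_n$, each with domain $\{0,1\}$. For $Q\subseteq\{V_1,\ldots,V_{n-1}\}$, $\mathrm{Inst}(Q)$ is the set of assignments of values in $\{0,1\}$ to the attributes of $Q$ (contexts); two contexts are consistent if they agree on their common attributes. A (complete) CPT $N$ for $V_n$ consists of a parent set $Pa(N,V_n)\subseteq\{V_1,\ldots,V_{n-1}\}$ and, for each $\gamma\in\mathrm{Inst}(Pa(N,V_n))$, exactly one rule, either $\gamma:0\succ 1$ or $\gamma:1\succ 0$. A swap over $V_n$ is identified with an element $x\in\{0,1\}^{n-1}$; the vote of $N$ on $x$ is $0$ if the rule of $N$ whose context agrees with $x$ on $Pa(N,V_n)$ is of the form $\gamma:0\succ1$, and $1$ otherwise. $\Delta(N,N')$ is the number of swaps on which $N,N'$ vote differently, and for a tuple $T=(N_1,\ldots,N_t)$ of CPTs for $V_n$, $f_T(N)=\sum_{s=1}^t\Delta(N,N_s)$. Algorithm 2, on input $(T,P)$: for each $\gamma\in\mathrm{Inst}(P)$ it computes $\mathit{zerovotes}(\gamma)=\sum_{s=1}^t r_s(\gamma)\cdot 2^{\,n-|Pa(N_s,V_n)|-1}/2^{\,|P\setminus Pa(N_s,V_n)|}$, where $r_s(\gamma)$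 is the number of rules of $N_s$ of the form $\delta:0\succ1$ with $\delta$ consistent with $\gamma$ (this equals the number of pairs $(x,s)$ with $x$ a swap agreeing with $\gamma$ on $P$ and $N_s$ voting $0$ on $x$), and $\mathit{onevotes}(\gamma)=t\cdot2^{\,n-|P|-1}-\mathit{zerovotes}(\gamma)$; it puts the rule $\gamma:0\succ1$ into the output CPT (parent set $P$) if $\mathit{zerovotes}(\gamma)>\mathit{onevotes}(\gamma)$ and $\gamma:1\succ0$ otherwise. Finally it removes irrelevant parents, i.e., attributes of $P$ on whose value the rule's preference never depends; this yields a CPT with a smaller parent set that casts the same vote on every swap. *)

(* Defs.v *)
From HB Require Import structures.
From mathcomp Require Import all_boot all_order all_algebra.
Set Implicit Arguments.
Unset Strict Implicit.
Unset Printing Implicit Defensive.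
Import Order.TTheory GRing.Theory Num.Theory.

(* The attributes V_1, ..., V_(n-1), numbered from 0; V_n itself is implicit,
   being the attribute that every CPT below describes.  The domain {0, 1} of
   an attribute is [bool], with [false] for 0 and [true] for 1. *)
Definition attr (n : nat) := 'I_n.-1.

Definition inst (n : nat) (Q : {set attr n}) := {ffun {i : attr n | i \in Q} -> bool}.

Definition consistent (n : nat) (Q P : {set attr n}) (d : inst Q) (g : inst P) : bool :=
  [forall i, forall j, (val i == val j) ==> (d i == g j)].

(* [rule N g] is the preferred value of V_n in context [g]: it is [false] when
   the rule is g : 0 > 1, and [true] when the rule is g : 1 > 0. *)
Record cpt (n : nat) := Cpt {
  pa : {set attr n};
  rule : inst pa -> bool
}.

Definition swap (n : nat) := {ffun attr n -> bool}.

Definition restrict (n : nat) (Q : {set attr n}) (x : swap n) : inst Q :=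
  [ffun i => x (val i)].

Definition vote (n : nat) (N : cpt n) (x : swap n) : bool :=
  rule (restrict (pa N) x).

Definition Delta (n : nat) (N N' : cpt n) : nat :=
  #|[set x : swap n | vote N x != vote N' x]|.

Definition f (n t : nat) (T : t.-tuple (cpt n)) (N : cpt n) : nat :=
  \sum_(s < t) Delta N (tnth T s).

Definition zerorules (n : nat) (N : cpt n) (P : {set attr n}) (g : inst P) : nat :=
  #|[set d : inst (pa N) | (rule d == false) && consistent d g]|.

Section Algorithm2.
Local Open Scope ring_scope.

Definition zerovotes (n t : nat) (T : t.-tuple (cpt n)) (P : {set attr n})
    (g : inst P) : rat :=
  \sum_(s < t) (zerorules (tnth T s) g)%:R
     * 2 ^+ (n - #|pa (tnth T s)| - 1) / 2 ^+ #|P :\: pa (tnth T s)|.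

Definition onevotes (n t : nat) (T : t.-tuple (cpt n)) (P : {set attr n})
    (g : inst P) : rat :=
  t%:R * 2 ^+ (n - #|P| - 1) - zerovotes T g.

Definition majority_cpt (n t : nat) (T : t.-tuple (cpt n)) (P : {set attr n}) : cpt n :=
  @Cpt n P (fun g => ~~ (onevotes T g < zerovotes T g)).

End Algorithm2.

Definition irrelevant (n : nat) (N : cpt n) (i : attr n) : bool :=
  [forall g : inst (pa N), forall g' : inst (pa N),
    [forall j, (val j != i) ==> (g j == g' j)] ==> (rule g == rule g')].

Definition relevant_parents (n : nat) (N : cpt n) : {set attr n} :=
  [set i in pa N | ~~ irrelevant N i].

(* The attributes of Q outside Q' get the value 0. *)
Definition extend0 (n : nat) (Q' Q : {set attr n}) (d : inst Q') : inst Q :=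
  [ffun j : {j : attr n | j \in Q} => if insub (val j) is Some k then d k else false].

(* As preferences do not depend on the irrelevant parents, any values may be
   given to these in order to look up the rule of [N]; 0 is used. *)
Definition remove_irrelevant (n : nat) (N : cpt n) : cpt n :=
  @Cpt n (relevant_parents N) (fun d => rule (extend0 (pa N) d)).

Definition algorithm2 (n t : nat) (T : t.-tuple (cpt n)) (P : {set attr n}) : cpt n :=
  remove_irrelevant (majority_cpt T P).

(* Main.v *)
Require Import Defs.
From HB Require Import structures.
From mathcomp Require Import all_boot all_order all_algebra.
From mathcomp Require Import zify.

(** Group the swaps by their restriction [g] to [P].  A CPT whose parents lie in
    [P] casts a single vote on each group, so it disagrees there with the input
    CPTs either on all pairs (swap, input CPT) voting 1 or on all those voting 0.
    Since [zerovotes T g] and [onevotes T g] count these pairs, taking the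
    majority minimises every group's contribution to [f T] separately. *)

Set Implicit Arguments.
Unset Strict Implicit.
Unset Printing Implicit Defensive.
Import Order.TTheory GRing.Theory Num.Theory.

Section Votes.
Variable n : nat.
Implicit Types (P Q : {set attr n}) (x y : swap n) (N : cpt n).

Lemma restrict_eqP Q x (g : inst Q) :
  reflect (forall i (iQ : i \in Q), x i = g (exist _ i iQ)) (restrict Q x == g).
Proof.
apply: (iffP eqP) => [<- i iQ|xg]; first by rewrite ffunE.
by apply/ffunP => -[i iQ]; rewrite ffunE xg.
Qed.

(** These swaps form a product family: one admissible value at each attribute of [Q], two at every
    other. *)
Lemma card_agree Q y :
  #|[set x : swap n | [forall i in Q, x i == y i]]| = 2 ^ (n.-1 - #|Q|).
Proof.
pose F (i : attr n) : pred bool := fun b => (i \in Q) ==> (b == y i).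
have -> : #|[set x : swap n | [forall i in Q, x i == y i]]| = #|family F|.
  by apply: eq_card => x; rewrite !inE.
rewrite card_family foldrE big_map big_enum /= (bigID (mem Q)) /= big1 ?mul1n.
  rewrite (eq_bigr (fun=> 2)) => [|i iNQ].
    rewrite prod_nat_const; congr (2 ^ _).
    by have := cardC (mem Q); rewrite card_ord => /(canRL (addKn _)).
  by rewrite -card_bool; apply: eq_card => b; rewrite unfold_in /F (negbTE iNQ).
move=> i iQ; rewrite -(card1 (y i)); apply: eq_card => b.
by rewrite unfold_in /F iQ.
Qed.

(** Consistent contexts glue to one swap [y], and the swaps counted are those that agree with [y] on
    [Q :|: P]. *)
Lemma card_restrict2 P Q (g : inst P) (d : inst Q) : consistent d g ->
  #|[set x | (restrict P x == g) && (restrict Q x == d)]|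
    = 2 ^ (n.-1 - #|Q :|: P|).
Proof.
move=> /forallP dg.
pose y : swap n := [ffun i => if insub i : option {i | i \in P} is Some k then g k
  else if insub i : option {i | i \in Q} is Some k then d k else false].
have yP i (iP : i \in P) : y i = g (exist _ i iP) by rewrite ffunE insubT.
have yQ i (iQ : i \in Q) : y i = d (exist _ i iQ).
  (* On attributes of both sets [y] takes its value from [g]; consistency identifies it with that of
     [d]. *)
  rewrite ffunE; case: insubP => [k _ ki|_]; last by rewrite insubT.
  have /forallP /(_ k) := dg (exist _ i iQ).
  by rewrite /= ki eqxx => /eqP.
rewrite -(card_agree _ y); apply: eq_card => x; rewrite !inE.
apply/andP/'forall_implyP => [[/restrict_eqP xP /restrict_eqP xQ] i|xy].
  by rewrite inE => /orP[iQ|iP]; rewrite ?(xQ _ iQ) ?(xP _ iP) ?(yQ _ iQ) ?(yP _ iP).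
by split; apply/restrict_eqP => i iPQ; rewrite -(yP, yQ);
  apply/eqP/xy; rewrite inE iPQ ?orbT.
Qed.

Lemma restrict_consistent P Q x : consistent (restrict Q x) (restrict P x).
Proof.
by apply/forallP => i; apply/forallP => j; apply/implyP => /eqP ij; rewrite !ffunE ij.
Qed.

(** Sort the swaps by their context on [pa N]: each zero rule consistent with [g] accounts for a
    class of the same size. *)
Lemma card_zerovoters N P (g : inst P) :
  #|[set x | (restrict P x == g) && ~~ vote N x]|
    = zerorules N g * 2 ^ (n.-1 - #|pa N :|: P|).
Proof.
rewrite /zerorules -2!sum1dep_card big_distrl /=.
rewrite (partition_big (restrict (pa N))
  (fun d => (rule d == false) && consistent d g)) /= => [|x].
  apply: eq_bigr => d /andP[/eqP d0 dg]; rewrite mul1n -(card_restrict2 dg).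
  rewrite -sum1dep_card; apply: eq_bigl => x.
  rewrite -andbA; congr andb; rewrite /vote.
  by case: eqP => [->|_]; rewrite ?d0 ?andbF.
by case/andP=> /eqP <- /negbTE v0; rewrite restrict_consistent -/(vote N x) v0.
Qed.

Lemma card_restrict P (g : inst P) :
  #|[set x | restrict P x == g]| = 2 ^ (n.-1 - #|P|).
Proof.
have gg : consistent g g.
  by apply/forallP => i; apply/forallP => j; apply/implyP => /eqP /val_inj ->.
by rewrite -[P in RHS]setUid -(card_restrict2 gg); apply: eq_card => x; rewrite !inE andbb.
Qed.

Section Instance.
Variables (t : nat) (T : t.-tuple (cpt n)).

Definition votes P (g : inst P) (b : bool) : nat :=
  \sum_(s < t) #|[set x | (restrict P x == g) && (vote (tnth T s) x == b)]|.

Lemma zerovotesE P (g : inst P) : zerovotes T g = (votes g false)%:R%R.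
Proof.
rewrite /zerovotes natr_sum; apply: eq_bigr => s _.
have -> : #|[set x | (restrict P x == g) && (vote (tnth T s) x == false)]|
    = #|[set x | (restrict P x == g) && ~~ vote (tnth T s) x]|.
  by apply: eq_card => x; rewrite !inE eqbF_neg.
rewrite card_zerovoters natrM natrX -mulrA; congr (_ * _)%R.
set A := pa _; have cU : #|A :|: P| = #|A| + #|P :\: A|.
  by rewrite cardsU cardsD setIC; have := subset_leq_card (subsetIl P A); lia.
have leU : #|A :|: P| <= n.-1 by have := max_card (mem (A :|: P)); rewrite card_ord.
(* The divisor [2 ^+ #|P :\: A|] thus cancels exactly; [leU] keeps the truncated subtraction
   harmless. *)
have -> : n - #|A| - 1 = (n.-1 - #|A :|: P|) + #|P :\: A| by lia.
by rewrite exprD mulfK // expf_neq0.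
Qed.

Lemma votesD P (g : inst P) :
  votes g false + votes g true = t * 2 ^ (n.-1 - #|P|).
Proof.
rewrite -big_split /= -[t in RHS]card_ord -sum_nat_const; apply: eq_bigr => s _.
rewrite -(card_restrict g) -!sum1dep_card addnC.
rewrite [RHS](bigID (fun x => vote (tnth T s) x)) /=.
by congr addn; apply: eq_bigl => x; rewrite ?eqb_id ?eqbF_neg.
Qed.

Lemma onevotesE P (g : inst P) : onevotes T g = (votes g true)%:R%R.
Proof.
rewrite /onevotes zerovotesE.
have -> : n - #|P| - 1 = n.-1 - #|P| by lia.
by rewrite -natrX -natrM -(votesD g) natrD addrAC subrr add0r.
Qed.

(** Stated with [h] rather than the rule of [N], so that the parent set of [N] may differ from
    [P]. *)
Lemma f_votes P N (h : inst P -> bool) :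
  (forall x, vote N x = h (restrict P x)) ->
  f T N = \sum_(g : inst P) votes g (~~ h g).
Proof.
move=> vN; rewrite exchange_big /=; apply: eq_bigr => s _.
rewrite /Delta -sum1dep_card (partition_big (restrict P) predT) //=.
apply: eq_bigr => g _; rewrite -sum1dep_card; apply: eq_bigl => x.
rewrite andbC vN; case: eqP => //= ->.
by case: (h g); case: (vote _ _).
Qed.

End Instance.

(** Irrelevance only allows changing one parent at a time, so [g] is turned into [g'] coordinate by
    coordinate, by induction on the number of differences. *)
Lemma eq_rule_relevant N (g g' : inst (pa N)) :
  (forall j, val j \in relevant_parents N -> g j = g' j) -> rule g = rule g'.
Proof.
have [k] := ubnP #|[set j | g j != g' j]|; elim: k g => // k IHk g lt_k gg'.
have [j gj|eqgg'] := pickP [pred j | g j != g' j]; last first.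
  by congr rule; apply/ffunP => j; have /negbFE/eqP := eqgg' j.
pose h : inst (pa N) := [ffun i => if i == j then g' i else g i].
have irrj : irrelevant N (val j).
  apply: contraNT gj => relj; apply/eqP/gg'; rewrite inE relj andbT.
  exact: valP.
have -> : rule g = rule h.
  have /forallP /(_ h) /implyP irr := forallP irrj g.
  apply/eqP/irr/forallP => i; apply/implyP => ij.
  by rewrite ffunE -val_eqE (negbTE ij).
apply: IHk => [|i /gg' gi]; last by rewrite ffunE gi if_same.
rewrite -ltnS; apply: leq_trans lt_k; rewrite ltnS; apply: proper_card.
apply/properP; split; last by exists j; rewrite inE // ffunE eqxx eqxx.
by apply/subsetP => i; rewrite !inE ffunE; case: ifP => // _; rewrite eqxx.
Qed.

Lemma vote_remove_irrelevant N x : vote (remove_irrelevant N) x = vote N x.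
Proof.
apply: (@eq_rule_relevant N) => j jrel.
by rewrite !ffunE insubT /= ffunE.
Qed.

(** Here [extend0] merely restricts from [P] to [pa N]; its default 0 is never reached. *)
Lemma vote_subset N P : pa N \subset P ->
  forall x, vote N x = rule (extend0 (pa N) (restrict P x)).
Proof.
move=> /subsetP NP x; congr rule; apply/ffunP => j.
by rewrite !ffunE insubT ?NP ?(valP j) // => jP; rewrite ffunE.
Qed.

End Votes.

Theorem theorem13 (n t : nat) (n_gt0 : 0 < n) (T : t.-tuple (cpt n))
    (P : {set attr n}) (N : cpt n) (paN : pa N \subset P) :
  f T (algorithm2 T P) <= f T N.
Proof.
rewrite (f_votes T (h := fun g => rule (extend0 (pa N) g)) (vote_subset paN)).
rewrite (f_votes T (vote_remove_irrelevant (majority_cpt T P))).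
(* On each group the output pays [votes g (votes g true < votes g false)], the smaller of the two
   counts, whichever way a tie is broken. *)
apply: leq_sum => g _; rewrite /= negbK onevotesE zerovotesE ltr_nat.
by case: ltnP => [/ltnW|] le_votes; case: rule.
Qed.
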